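(* Let $0<\tilde\beta<\tilde\alpha$. Consider the Poisson observation model $\boldsymbol{\mathscr{X}}\sim\mathrm{Poisson}(\boldsymbol{\mathscr{M}})$ for $N$-way $I\times\cdots\times I$ tensors ($N\ge 2$), and let $\inf_{\widehat{\boldsymbol{\mathscr{M}}}}$ denote the infimum over all estimators $\widehat{\boldsymbol{\mathscr{M}}}\in\mathcal{S}_R(\tilde\beta,\tilde\alpha)$ based on the count tensor observation $\boldsymbol{\mathscr{X}}$. Assume that $R\le I$, $IR>16$, and that $$\Big(\frac{IR}{16}-1\Big)\frac{\tilde\beta\log 2}{(\tilde\alpha-\tilde\beta)^2}\le I^N .$$ Then $$\inf_{\widehat{\boldsymbol{\mathscr{M}}}}\ \sup_{\boldsymbol{\mathscr{M}}\in\mathcal{S}_R(\tilde\beta,\tilde\alpha)}\mathbb{E}\big\|\widehat{\boldsymbol{\mathscr{M}}}-\boldsymbol{\mathscr{M}}\big\|_F^2\ \ge\ \frac{\tilde\beta\log 2}{128}\Big(\frac{IR}{16}-1\Big).$$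
   Context: $\circ$ denotes the vector outer product. The parameter class is $$\mathcal{S}_R(\tilde\beta,\tilde\alpha)=\Big\{\boldsymbol{\mathscr{T}}=\sum_{r=1}^R\mathbf{w}_r^{(1)}\circ\cdots\circ\mathbf{w}_r^{(N)}\ \Big|\ \mathbf{w}_r^{(n)}\in\mathbb{R}^I,\ \tilde\beta\le t_{\mathbf{i}}\le\tilde\alpha\ \text{for all }\mathbf{i}\in\{1,\dots,I\}^N\Big\},$$ where $t_{\mathbf{i}}$ is the entry of $\boldsymbol{\mathscr{T}}$ at $\mathbf{i}$. $\boldsymbol{\mathscr{X}}\sim\mathrm{Poisson}(\boldsymbol{\mathscr{M}})$ means that the entries $x_{\mathbf{i}}$ of $\boldsymbol{\mathscr{X}}$ are independent with $\mathbb{P}(x_{\mathbf{i}}=k)=m_{\mathbf{i}}^ke^{-m_{\mathbf{i}}}/k!$ for every $k\in\mathbb{N}$ (including $k=0$), where $m_{\mathbf{i}}$ are the entries of $\boldsymbol{\mathscr{M}}$. An estimator is a (measurable) function of $\boldsymbol{\mathscr{X}}$; the expectation is over $\boldsymbol{\mathscr{X}}\sim\mathrm{Poisson}(\boldsymbol{\mathscr{M}})$. $\|\cdot\|_F$ is the Frobenius norm. *)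

(* Defs.v *)
From mathcomp Require Import all_boot all_order all_algebra.
From mathcomp Require Import all_classical all_reals all_analysis.

Set Implicit Arguments.
Unset Strict Implicit.
Unset Printing Implicit Defensive.

Import Order.TTheory GRing.Theory Num.Theory.

Local Open Scope classical_set_scope.
Local Open Scope ring_scope.

(* N-way I x ... x I tensors with entries in T; indices in {1, .., I} are
   shifted to 'I_I. *)
Notation multi_index N I := {ffun 'I_N -> 'I_I}.
Notation tensor N I T := {ffun {ffun 'I_N -> 'I_I} -> T}.

Definition outer (K : realType) (N I : nat) (w : 'I_N -> 'cV[K]_I) :
    tensor N I K :=
  [ffun i : multi_index N I => \prod_(n < N) w n (i n) 0].

Definition frobenius_norm (K : realType) (N I : nat) (T : tensor N I K) : K :=
  Num.sqrt (\sum_(i : multi_index N I) T i ^+ 2).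

Definition cp_class (K : realType) (N I R : nat) (beta alpha : K) :
    set (tensor N I K) :=
  [set T | (exists w : 'I_R -> 'I_N -> 'cV[K]_I,
              T = \sum_(r < R) outer (w r)) /\
           (forall i : multi_index N I, beta <= T i <= alpha)].

Definition mutually_independent d (Omega : measurableType d) (K : realType)
    (P : probability Omega K) (J : finType) d' (E : measurableType d')
    (X : J -> Omega -> E) : Prop :=
  forall (L : {set J}) (A : J -> set E),
    (forall j, j \in L -> measurable (A j)) ->
    P (\bigcap_(j in [set` L]) (X j @^-1` A j)) =
      (\prod_(j in L) P (X j @^-1` A j))%E.

(* The probability mass function is spelled out because the library's
   [poisson_pmf] is constantly 1 when the rate is 0. *)
Definition poisson_tensor d (Omega : measurableType d) (K : realType)
    (P : probability Omega K) (N I : nat)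
    (X : Omega -> tensor N I nat) (M : tensor N I K) : Prop :=
  [/\ forall i : multi_index N I,
        measurable_fun [set: Omega] (fun omega => X omega i),
      mutually_independent P (fun i omega => X omega i) &
      forall (i : multi_index N I) (k : nat),
        P [set omega | X omega i = k] =
          (M i ^+ k * expR (- M i) / k`!%:R)%:E].

(* The count tensors form a countable set, on which every function is
   measurable for the discrete sigma-algebra; hence no measurability
   condition on estimators. *)
Definition estimators (K : realType) (N I : nat) (S : set (tensor N I K)) :
    set (tensor N I nat -> tensor N I K) :=
  [set Mhat | forall x, S (Mhat x)].

Definition risk d (Omega : measurableType d) (K : realType)
    (P : probability Omega K) (N I : nat) (X : Omega -> tensor N I nat)
    (Mhat : tensor N I nat -> tensor N I K) (M : tensor N I K) : \bar K :=
  ('E_P [fun omega => (frobenius_norm (Mhat (X omega) - M) ^+ 2)%R])%E.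

(* [P M] is the probability on the sample space when the parameter is [M]. *)
Definition minimax_risk d (Omega : measurableType d) (K : realType)
    (N I : nat) (P : tensor N I K -> probability Omega K)
    (X : Omega -> tensor N I nat) (S : set (tensor N I K)) : \bar K :=
  ereal_inf [set ereal_sup [set risk (P M) X Mhat M | M in S]
            | Mhat in estimators S].

(* Main.v *)
Require Import Defs.
From mathcomp Require Import all_boot all_order all_algebra.
From mathcomp Require Import all_classical all_reals all_analysis.
From mathcomp Require Import measurable_realfun.
From mathcomp Require Import ring lra.

Set Implicit Arguments.
Unset Strict Implicit.
Unset Printing Implicit Defensive.

Import Order.TTheory GRing.Theory Num.Theory.

Local Open Scope classical_set_scope.
Local Open Scope ring_scope.

(** The bound is an instance of Assouad's hypercube method.

    Write [Q = (I R / 16 - 1) beta ln 2] and choose [delta] with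
    [delta^2 I^N = Q]; the size hypothesis says exactly that
    [beta + delta <= alpha].  A table [theta] of [I x R] numbers yields the
    tensor with entries [theta (i_0, i_1 mod R)].  It has CP rank at most [R]:
    the [r]-th component has the [r]-th column of [theta] as its first factor,
    the indicator of [i_1 = r mod R] as its second one, and constant vectors
    elsewhere ([block_tensor_cp_class]).  The vertices of the hypercube are the
    tables with entries in [{beta, beta + delta}].

    Changing one entry of the table changes the tensor at no more than
    [2 I^(N-1) / R] positions ([card_cell_fiber]), by [delta] at each.  The two
    Poisson laws are then hard to tell apart: if [M] is the entrywise geometric
    mean of [M0] and [M1], their probability mass functions satisfy
    [p0 p1 = (kappa p)^2], where [kappa] is the Hellinger affinity
    ([poisson_weight_mul]).  Since [p] has mass 1, integrating an elementary
    pointwise inequality ([two_point_sqr_error]) shows that at any position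
    where the tensors differ by [delta], the two squared errors of an estimator add up
    to at least [delta^2 (kappa - 1/2)] in mean ([poisson_two_point]).  The
    geometric mean of two neighbouring vertices still has its entries between
    [beta] and [beta + delta], so the model does provide an observation with that
    law.

    Now fix a position and average its error over the hypercube, pairing every
    vertex with its neighbour across the coordinate that governs the position;
    then sum over the positions.  The average risk is at least
    [Q (kappa - 1/2) / 2], with [kappa >= 63/64], and the supremum dominates the
    average ([cp_class_sup_risk_ge]).  This is far above [Q / 128]. *)

(** * Integrals of functions of a countably-valued random variable *)

Section CountableValued.
Context d (Omega : measurableType d) (K : realType) (T : countType).
Variable X : Omega -> T.
Hypothesis mX : forall x, measurable [set omega | X omega = x].

Let F k := [set omega | pickle (X omega) = k].

Let F_fiber x : F (pickle x) = [set omega | X omega = x].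
Proof.
by apply/seteqP; split=> w /=; [move/(pcan_inj (@pickleK T)) | move=> <-].
Qed.

Let mF k : measurable (F k).
Proof.
have [[x <-]|nx] := pselect (exists x : T, pickle x = k).
  by rewrite F_fiber; exact: mX.
suff -> : F k = set0 by exact: measurable0.
by apply/seteqP; split=> w //= wk; apply: nx; exists (X w).
Qed.

(** A preimage is a countable union of fibres of [X]. *)
Lemma measurable_fun_countable_valued (h : T -> \bar K) :
  measurable_fun [set: Omega] (fun omega => h (X omega)).
Proof.
move=> _ Y mY; rewrite setTI.
have -> : (fun omega => h (X omega)) @^-1` Y =
    \bigcup_k (F k `&` [set omega | Y (h (X omega))]).
  by apply/seteqP; split=> w /= => [Yw|[k _ []]//]; exists (pickle (X w)).
apply: bigcupT_measurable => k.
have [[x xk Yx]|nx] := pselect (exists2 x : T, pickle x = k & Y (h x)).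
  suff -> : F k `&` [set omega | Y (h (X omega))] = F k by exact: mF.
  apply/seteqP; split=> w /=; first by case.
  by move=> wk; split=> //; rewrite (pcan_inj (@pickleK T) (etrans wk (esym xk))).
suff -> : F k `&` [set omega | Y (h (X omega))] = set0 by exact: measurable0.
by apply/seteqP; split=> w //= [wk Yw]; apply: nx; exists (X w).
Qed.

(** The fibres of [X], numbered by [pickle], partition the sample space, and the
    integrand is constant on each of them. *)
Lemma ge0_integral_countable_valued (mu : {measure set Omega -> \bar K})
    (h : T -> K) : (forall x, 0 <= h x) ->
  (\int[mu]_omega (h (X omega))%:E =
   \sum_(0 <= k <oo)
     (if pickle_inv k is Some x then (h x)%:E * mu [set omega | X omega = x]
      else 0))%E.
Proof.
move=> h0.
have UF : \bigcup_k F k = [set: Omega].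
  by apply/seteqP; split=> w //= _; exists (pickle (X w)).
rewrite -UF ge0_integral_bigcup//.
- apply: eq_eseriesr => k _.
  case E : (pickle_inv k) => [x|].
    have <- : pickle x = k by have := @pickle_invK T k; rewrite E.
    rewrite F_fiber -integral_cst; last exact: mX.
    by apply: eq_integral => w; rewrite inE/= => ->.
  suff -> : F k = set0 by rewrite integral_set0.
  apply/seteqP; split=> w //= wk.
  by move: E; rewrite -wk pickleK_inv.
- by rewrite UF; exact: (measurable_fun_countable_valued (EFin \o h)).
- by move=> w _; rewrite lee_fin.
- by move=> k l _ _ [w [/= <- <-]].
Qed.

(** A pointwise inequality between weighted probability mass functions passes
    to expectations; the constant [c] on the left is the expectation of [c]
    under [mu]. *)
Lemma le_integral_pmf (mu0 mu1 mu : probability Omega K)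
    (a b : T -> K) (c : K) :
  (forall x, 0 <= a x) -> (forall x, 0 <= b x) -> 0 <= c ->
  (forall x, c%:E * mu [set omega | X omega = x] <=
     (a x)%:E * mu0 [set omega | X omega = x] +
     (b x)%:E * mu1 [set omega | X omega = x])%E ->
  (c%:E <= \int[mu0]_omega (a (X omega))%:E + \int[mu1]_omega (b (X omega))%:E)%E.
Proof.
move=> a0 b0 c0 abc.
rewrite -[leLHS]mule1 -(@probability_setT _ _ _ mu).
rewrite -[leLHS](integral_cst mu measurableT).
rewrite (@ge0_integral_countable_valued mu (fun=> c))//.
rewrite !ge0_integral_countable_valued//.
have nneg (m : {measure set Omega -> \bar K}) (g : T -> K) k :
    (forall x, 0 <= g x) ->
    (0 <= if pickle_inv k is Some x then (g x)%:E * m [set omega | X omega = x]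
     else 0)%E.
  by move=> g0; case: pickle_inv => // x; rewrite mule_ge0 ?lee_fin.
rewrite -nneseriesD; try by move=> k _ _; exact: nneg.
apply: lee_nneseries => [k _ _|k _]; first exact: (nneg mu (fun=> c)).
by case: pickle_inv => [x|]; [exact: abc | rewrite adde0].
Qed.

End CountableValued.

(** * Joint laws of Poisson tensors *)

Section Poisson.
Context d (Omega : measurableType d) (K : realType) (N I : nat).
Implicit Types (P : probability Omega K) (M : tensor N I K).
Variable X : Omega -> tensor N I nat.

Let atomE (x : tensor N I nat) :
  [set omega | X omega = x] =
  \bigcap_(i in [set` [set: multi_index N I]%SET])
    ((fun omega => X omega i) @^-1` [set x i]).
Proof.
apply/seteqP; split=> w /=; first by move=> <- i _.
by move=> wx; apply/ffunP => i; apply: wx; rewrite /= inE.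
Qed.

Lemma poisson_tensor_measurable P M : poisson_tensor P X M ->
  forall x, measurable [set omega | X omega = x].
Proof.
move=> [mX _ _] x; rewrite atomE; apply: fin_bigcap_measurable.
  exact: finite_finset.
by move=> i _; rewrite -[_ @^-1` _]setTI; exact: mX.
Qed.

Definition poisson_weight M (x : tensor N I nat) : K :=
  \prod_i (M i ^+ x i * expR (- M i) / (x i)`!%:R).

Lemma poisson_tensor_pmf P M : poisson_tensor P X M ->
  forall x, P [set omega | X omega = x] = (poisson_weight M x)%:E.
Proof.
move=> [mX indX pmfX] x; rewrite atomE (indX _ (fun i => [set x i]))//.
rewrite /poisson_weight -prodEFin; apply: eq_big => [i|i _]; first by rewrite inE.
exact: pmfX.
Qed.

Lemma poisson_weight_ge0 M x : (forall i, 0 <= M i) -> 0 <= poisson_weight M x.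
Proof.
by move=> M0; apply: prodr_ge0 => i _; rewrite !mulr_ge0 ?exprn_ge0 ?expR_ge0.
Qed.

(** Entrywise, [a^k e^-a b^k e^-b = (m^k e^-m)^2 e^-(a + b - 2m)] as soon as
    [a b = m^2].  The exponential on the right is the Hellinger affinity: when
    [m] is the square root of [a b], [a + b - 2 m] is the squared difference of
    the square roots of [a] and [b]. *)
Lemma poisson_weight_mul M0 M1 M x : (forall i, M0 i * M1 i = M i ^+ 2) ->
  poisson_weight M0 x * poisson_weight M1 x =
  (expR (- (\sum_i (M0 i + M1 i - 2 * M i)) / 2) * poisson_weight M x) ^+ 2.
Proof.
move=> M01; rewrite exprMn -expRM_natl.
rewrite (_ : 2%:R * _ = - \sum_i (M0 i + M1 i - 2 * M i)); last first.
  by rewrite mulrC divfK.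
rewrite -sumrN expR_sum -big_split/= -prodrXl -big_split/=.
apply: eq_bigr => i _.
have expE : expR (- M0 i) * expR (- M1 i) =
    expR (- (M0 i + M1 i - 2 * M i)) * expR (- M i) ^+ 2.
  by rewrite -expRM_natl -!expRD; congr expR; ring.
have regroup (a b m e0 e1 E e f : K) n :
    a * b = m ^+ 2 -> e0 * e1 = E * e ^+ 2 ->
    a ^+ n * e0 / f * (b ^+ n * e1 / f) = E * (m ^+ n * e / f) ^+ 2.
  move=> ab e01; rewrite mulrACA [a ^+ n * _ * _]mulrACA -exprMn ab e01.
  by rewrite -exprM mulnC exprM !exprMn; ring.
exact: regroup.
Qed.

End Poisson.

(** Minimising over [h] gives
    [p (h - u)^2 + q (h - v)^2 >= (v - u)^2 p q / (p + q)]; then [p q = g^2] and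
    [g^2 / s >= g - s / 4] with [s = p + q].  The result is linear in [p], [q]
    and [g], hence can be integrated. *)
Lemma two_point_sqr_error (K : realType) (p q g u v h : K) :
  0 <= p -> 0 <= q -> p * q = g ^+ 2 ->
  (v - u) ^+ 2 * g <=
    ((h - u) ^+ 2 + (v - u) ^+ 2 / 4) * p + ((h - v) ^+ 2 + (v - u) ^+ 2 / 4) * q.
Proof.
move=> p0 q0 pq.
have [s0|s0] := eqVneq (p + q) 0.
  move/eqP: s0; rewrite paddr_eq0// => /andP[/eqP p00 /eqP q00].
  have g0 : g = 0 by apply/eqP; rewrite -sqrf_eq0 -pq p00 mul0r.
  by rewrite p00 q00 g0 !mulr0 addr0.
have s_gt0 : 0 < p + q by rewrite lt_def s0 addr_ge0.
rewrite -subr_ge0 -(pmulr_rge0 _ s_gt0).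
(* After multiplication by [p + q], the difference is a sum of two squares. *)
suff -> : (p + q) * (((h - u) ^+ 2 + (v - u) ^+ 2 / 4) * p +
      ((h - v) ^+ 2 + (v - u) ^+ 2 / 4) * q - (v - u) ^+ 2 * g) =
    (v - u) ^+ 2 * (g - (p + q) / 2) ^+ 2 +
    ((p + q) * (h - u) - (v - u) * q) ^+ 2.
  by rewrite addr_ge0 ?sqr_ge0// mulr_ge0 ?sqr_ge0.
have -> : (g - (p + q) / 2) ^+ 2 = p * q - g * (p + q) + (p + q) ^+ 2 / 4.
  by rewrite pq; field.
by field.
Qed.

(** Le Cam's two-point argument, with the Hellinger affinity in place of the
    total variation distance.  Taking the law [P] of the geometric mean [M] as
    the reference measure avoids integrating square roots of densities. *)
Lemma poisson_two_point d (Omega : measurableType d) (K : realType)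
    (N I : nat) (X : Omega -> tensor N I nat)
    (P0 P1 P : probability Omega K) (M0 M1 M : tensor N I K)
    (h : tensor N I nat -> K) (u v : K) :
  poisson_tensor P0 X M0 -> poisson_tensor P1 X M1 -> poisson_tensor P X M ->
  (forall i, 0 <= M0 i) -> (forall i, 0 <= M1 i) -> (forall i, 0 <= M i) ->
  (forall i, M0 i * M1 i = M i ^+ 2) ->
  (((v - u) ^+ 2 *
      (expR (- (\sum_i (M0 i + M1 i - 2 * M i)) / 2) - 1 / 2))%:E <=
    \int[P0]_omega ((h (X omega) - u) ^+ 2)%:E +
    \int[P1]_omega ((h (X omega) - v) ^+ 2)%:E)%E.
Proof.
move=> X0 X1 XM M0ge0 M1ge0 Mge0 M01.
have mX := poisson_tensor_measurable XM.
set kappa := expR _; set D := (v - u) ^+ 2.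
have D0 : 0 <= D by exact: sqr_ge0.
have intD (Q : probability Omega K) w :
    (\int[Q]_omega ((h (X omega) - w) ^+ 2 + D / 4)%:E =
     \int[Q]_omega ((h (X omega) - w) ^+ 2)%:E + (D / 4)%:E)%E.
  under eq_integral do rewrite EFinD.
  rewrite ge0_integralD//=.
  - congr (_ + _)%E; rewrite -[RHS]mule1 -(@probability_setT _ _ _ Q).
    exact: (integral_cst Q measurableT).
  - by move=> t _; rewrite lee_fin sqr_ge0.
  - exact: (measurable_fun_countable_valued mX (fun x => ((h x - w) ^+ 2)%:E)).
  - by move=> t _; rewrite lee_fin divr_ge0.
have := @le_integral_pmf _ _ K _ X mX P0 P1 P
  (fun x => (h x - u) ^+ 2 + D / 4) (fun x => (h x - v) ^+ 2 + D / 4)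
  (D * kappa).
rewrite !intD => le_int.
rewrite [D * _](_ : _ = D * kappa - (D / 4 + D / 4)); last by field.
rewrite EFinB leeBlDr// EFinD addeACA; apply: le_int => [x|x||x].
- by rewrite addr_ge0 ?divr_ge0 ?sqr_ge0.
- by rewrite addr_ge0 ?divr_ge0 ?sqr_ge0.
- by rewrite mulr_ge0 ?expR_ge0.
rewrite (poisson_tensor_pmf X0) (poisson_tensor_pmf X1) (poisson_tensor_pmf XM).
rewrite -!EFinM -EFinD lee_fin -mulrA.
apply: two_point_sqr_error; try exact: poisson_weight_ge0.
exact: poisson_weight_mul.
Qed.

(** * Block tensors *)

Section BlockTensor.
Context (K : realType) (N I R : nat).

(** Reducing the second coordinate modulo the rank repeats the table about
    [I / R] times along that direction, so that each of its entries fills about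
    the same number of positions of the tensor. *)
Definition cell (i : multi_index N.+2 I) : 'I_I * 'I_R.+1 :=
  (i ord0, inord (i (lift ord0 ord0) %% R.+1)).

Definition block_tensor (theta : {ffun 'I_I * 'I_R.+1 -> K}) :
    tensor N.+2 I K :=
  [ffun i => theta (cell i)].

(** The indicators of the residue classes form the second factors; in the sum
    over [r], only the residue of the second index survives. *)
Lemma block_tensor_cp_class (beta alpha : K)
    (theta : {ffun 'I_I * 'I_R.+1 -> K}) :
  (forall c, beta <= theta c <= alpha) ->
  cp_class R.+1 beta alpha (block_tensor theta).
Proof.
move=> theta_itv; split=> [|i]; last by rewrite ffunE.
exists (fun r n => if n == ord0 then \col_a theta (a, r)
  else if n == lift ord0 ord0 then
    \col_a (inord (a %% R.+1) == r)%:R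
  else const_mx 1).
apply/ffunP => i; rewrite ffunE sum_ffunE.
under eq_bigr => r _.
  rewrite ffunE !big_ord_recl big1 => [|n _]; last by rewrite /= mxE.
  rewrite /= !mxE mulr1.
  over.
rewrite (bigD1 (cell i).2)//= eqxx mulr1 big1 ?addr0// => r.
by rewrite eq_sym => /negbTE ->; rewrite mulr0.
Qed.

(** The quotient by [R.+1] is injective on a residue class, so the class has at
    most [I %/ R.+1 + 1] elements. *)
Lemma card_modn_fiber (r : 'I_R.+1) :
  (R.+1 <= I)%N ->
  (#|[pred a : 'I_I | inord (a %% R.+1) == r]| * R.+1 <= 2 * I)%N.
Proof.
move=> RI; set A := [pred a : 'I_I | _].
have quo_lt (a : 'I_I) : (a %/ R.+1 < (I %/ R.+1).+1)%N.
  by rewrite ltnS leq_div2r// ltnW.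
have cardA : (#|A| <= (I %/ R.+1).+1)%N.
  rewrite -[leqRHS]card_ord; apply: (leq_card_in (fun a => Ordinal (quo_lt a))).
  move=> a b /eqP ar /eqP br [ab]; apply: ord_inj.
  rewrite (divn_eq a R.+1) [RHS](divn_eq b R.+1) ab; congr (_ + _)%N.
  by rewrite -[LHS](@inordK R) ?ltn_mod// ar -br inordK ?ltn_mod.
rewrite (leq_trans (leq_mul cardA (leqnn _)))// mulSn mul2n -addnn leq_add//.
exact: leq_trunc_div.
Qed.

(** A fibre is a product: a point in the first direction, a residue class in the
    second one, everything in the others. *)
Lemma card_cell_fiber (c : 'I_I * 'I_R.+1) : (R.+1 <= I)%N ->
  (#|[pred i | cell i == c]| * R.+1 <= 2 * I ^ N.+1)%N.
Proof.
move=> RI; pose A := [pred a : 'I_I | inord (a %% R.+1) == c.2].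
pose F (n : 'I_N.+2) : pred 'I_I := if n == ord0 then pred1 c.1
  else if n == lift ord0 ord0 then A else predT.
have -> : #|[pred i | cell i == c]| = #|family F|.
  apply: eq_card => i; rewrite !inE; apply/idP/familyP.
    move=> /eqP ic n; rewrite /F /A -ic.
    case: eqP => [->|_]; first by rewrite inE.
    by case: eqP => [->|_]; rewrite !inE.
  move=> iF; have := iF ord0; have := iF (lift ord0 ord0).
  rewrite /F /A /= !inE => /eqP i1 /eqP i0.
  by rewrite /cell i1 i0 -surjective_pairing.
rewrite card_family foldrE big_map big_enum/= !big_ord_recl/=.
rewrite [F _]/= card1 mul1n [F _]/=.
under eq_bigr do rewrite [F _]/= cardT size_enum_ord.
rewrite prod_nat_const card_ord mulnAC expnS mulnA leq_mul2r card_modn_fiber//.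
by rewrite orbT.
Qed.

End BlockTensor.
Arguments cell {N I} R i.

(** * Averaging over the hypercube *)

(** With [s] and [t] the square roots of [beta] and [beta + delta], the left-hand
    side is [(t - s)^2], and [delta = (t - s) (t + s) >= (t - s) (2 s)]. *)
Lemma poisson_hellinger_le (K : realType) (beta delta : K) :
  0 < beta -> 0 <= delta ->
  beta + (beta + delta) - 2 * Num.sqrt (beta * (beta + delta)) <=
    delta ^+ 2 / (4 * beta).
Proof.
move=> b0 d0; have bd0 : 0 <= beta + delta by rewrite addr_ge0// ltW.
rewrite sqrtrM ?(ltW b0)// ler_pdivlMr ?mulr_gt0//.
have s0 := sqrtr_ge0 beta; have t0 := sqrtr_ge0 (beta + delta).
have st : Num.sqrt beta <= Num.sqrt (beta + delta).
  by rewrite ler_sqrt// lerDl.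
have sE := sqr_sqrtr (ltW b0); have tE := sqr_sqrtr bd0.
move: (Num.sqrt beta) (Num.sqrt (beta + delta)) s0 t0 st sE tE.
move=> s t s0 t0 st sE tE.
have -> : delta = t ^+ 2 - s ^+ 2 by rewrite sE tE addrAC subrr add0r.
rewrite -sE.
have -> : s ^+ 2 + (s ^+ 2 + (t ^+ 2 - s ^+ 2)) - 2 * (s * t) = (t - s) ^+ 2 by ring.
have -> : (t ^+ 2 - s ^+ 2) ^+ 2 = (t - s) ^+ 2 * (t + s) ^+ 2 by ring.
apply: ler_wpM2l; first exact: sqr_ge0.
rewrite (_ : 4 * s ^+ 2 = (s + s) ^+ 2); last by ring.
by rewrite lerXn2r ?nnegrE ?addr_ge0// lerD2r.
Qed.

Lemma le_of_le_sum (K : realType) (V : finType) (r : V -> \bar K) (B : \bar K)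
    (l : K) : (0 < #|V|)%N ->
  (forall v, r v <= B)%E -> ((#|V|%:R * l)%:E <= \sum_v r v)%E ->
  (l%:E <= B)%E.
Proof.
move=> V0 rB lr; rewrite -(@lee_pmul2l _ #|V|%:R%:E)//; last first.
  by rewrite lte_fin ltr0n.
rewrite -EFinM (le_trans lr)// mule_natl.
have <- : (\sum_(v : V) B = B *+ #|V|)%E by rewrite sumr_const.
by apply: lee_sum => v _; exact: rB.
Qed.

Definition flip (C : finType) (c : C) (A : {ffun C -> bool}) :
    {ffun C -> bool} :=
  [ffun c' => A c' (+) (c' == c)].

Lemma flipK (C : finType) (c : C) : involutive (flip c).
Proof. by move=> A; apply/ffunP => c'; rewrite !ffunE addbK. Qed.

(** Flipping a coordinate permutes the vertices, so twice the sum of [G] is the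
    sum of [G A + G (flip c A)]. *)
Lemma sum_flip_ge (K : realType) (C : finType) (c : C)
    (G : {ffun C -> bool} -> \bar K) (D : K) :
  (forall A, D%:E <= G A + G (flip c A))%E ->
  ((#|{ffun C -> bool}|%:R * (D / 2))%:E <= \sum_A G A)%E.
Proof.
move=> GD; set n := #|_|.
have : ((n%:R * D)%:E <= \sum_A G A + \sum_A G A)%E.
  rewrite [X in (_ + X)%E](reindex_inj (inv_inj (flipK c)))/= -big_split/=.
  rewrite EFinM mule_natl.
  have <- : (\sum_(A : {ffun C -> bool}) D%:E = D%:E *+ n)%E.
    by rewrite sumr_const.
  by apply: lee_sum => A _; exact: GD.
case: (\sum_A G A)%E => [r||//]; last by move=> _; exact: leey.
by rewrite -EFinD !lee_fin mulrA ler_pdivrMr// mulr_natr mulr2n.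
Qed.

Lemma risk_sum d (Omega : measurableType d) (K : realType)
    (P : probability Omega K) (N I : nat) (X : Omega -> tensor N I nat)
    (Mhat : tensor N I nat -> tensor N I K) (M : tensor N I K) :
  poisson_tensor P X M ->
  risk P X Mhat M =
    (\sum_i \int[P]_omega ((Mhat (X omega) i - M i) ^+ 2)%:E)%E.
Proof.
move=> XM; rewrite /risk unlock.
under eq_integral => w _.
  rewrite /frobenius_norm sqr_sqrtr; last by apply: sumr_ge0 => i _; exact: sqr_ge0.
  rewrite -sumEFin.
  under eq_bigr do rewrite !ffunE.
  over.
rewrite ge0_integral_sum//.
- move=> i; apply: (measurable_fun_countable_valued
    (poisson_tensor_measurable XM) (fun x => ((Mhat x i - M i) ^+ 2)%:E)).
- by move=> i w _; rewrite lee_fin sqr_ge0.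
Qed.

Section Assouad.
Context d (Omega : measurableType d) (K : realType) (N I R : nat).
Variables (P : tensor N.+2 I K -> probability Omega K).
Variable X : Omega -> tensor N.+2 I nat.
Variables beta delta alpha : K.
Hypotheses (beta0 : 0 < beta) (delta0 : 0 <= delta).
Hypothesis alpha_ge : beta + delta <= alpha.
Hypothesis RI : (R.+1 <= I)%N.
Hypothesis hX : forall M : tensor N.+2 I K,
  cp_class R.+1 beta alpha M -> poisson_tensor (P M) X M.

Let vertex (A : {ffun 'I_I * 'I_R.+1 -> bool}) : tensor N.+2 I K :=
  block_tensor N [ffun c => beta + (A c)%:R * delta].

Let vertex_class A : cp_class R.+1 beta alpha (vertex A).
Proof.
apply: block_tensor_cp_class => c; rewrite ffunE lerDl.
rewrite mulr_ge0 ?ler0n//= (le_trans _ alpha_ge)// lerD2l.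
by case: (A c); rewrite ?mul1r ?mul0r.
Qed.

(** An upper bound for [- ln kappa], hence for [1 - kappa], with [kappa] the
    affinity between neighbouring vertices. *)
Let gap : K := delta ^+ 2 * I%:R ^+ N.+1 / (4 * beta * R.+1%:R).

Let error (Mhat : tensor N.+2 I nat -> tensor N.+2 I K) i A : \bar K :=
  (\int[P (vertex A)]_omega ((Mhat (X omega) i - vertex A i) ^+ 2)%:E)%E.

(** The two vertices differ exactly on the fibre of [cell R i], by [delta] at
    each position, and [i] belongs to this fibre; [gap] bounds what their
    affinity loses. *)
Lemma vertex_pair_error Mhat i A :
  ((delta ^+ 2 * (1 / 2 - gap))%:E <=
    error Mhat i A + error Mhat i (flip (cell R i) A))%E.
Proof.
pose mid := Num.sqrt (beta * (beta + delta)).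
have bd0 : 0 <= beta + delta by rewrite addr_ge0// ltW.
have mid0 : 0 <= mid by exact: sqrtr_ge0.
have midE : mid ^+ 2 = beta * (beta + delta).
  by rewrite sqr_sqrtr// mulr_ge0// ltW.
have beta_le : beta <= beta + delta by rewrite lerDl.
have mid_lo : beta <= mid.
  rewrite -(@ler_pXn2r _ 2)// ?nnegrE ?(ltW beta0)// midE expr2.
  by rewrite ler_wpM2l// ltW.
have mid_hi : mid <= beta + delta.
  rewrite -(@ler_pXn2r _ 2)// ?nnegrE// midE expr2.
  by rewrite ler_wpM2r.
(* The geometric mean of the vertex [A] and its neighbour. *)
pose M := block_tensor N
  [ffun c => if c == cell R i then mid else beta + (A c)%:R * delta].
have M_class : cp_class R.+1 beta alpha M.
  apply: block_tensor_cp_class => c; rewrite ffunE; case: ifP => _.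
    by rewrite mid_lo (le_trans mid_hi).
  rewrite lerDl mulr_ge0 ?ler0n//= (le_trans _ alpha_ge)// lerD2l.
  by case: (A c); rewrite ?mul1r ?mul0r.
have ge0 (T : tensor N.+2 I K) : cp_class R.+1 beta alpha T ->
    forall j, 0 <= T j.
  by move=> [_ T_itv] j; case/andP: (T_itv j) => + _; exact: le_trans (ltW beta0).
have M_geom j : vertex A j * vertex (flip (cell R i) A) j = M j ^+ 2.
  rewrite !ffunE; have [->|_] := eqVneq (cell R j) (cell R i).
    by rewrite midE; case: (A _) => /=; ring.
  by rewrite addbF.
have M_gap j : vertex A j + vertex (flip (cell R i) A) j - 2 * M j =
    (cell R j == cell R i)%:R * (beta + (beta + delta) - 2 * mid).
  rewrite !ffunE; have [->|_] := eqVneq (cell R j) (cell R i).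
    by case: (A _) => /=; ring.
  by rewrite addbF /=; ring.
have := poisson_two_point (fun x : tensor N.+2 I nat => Mhat x i) (vertex A i)
  (vertex (flip (cell R i) A) i) (hX (vertex_class A))
  (hX (vertex_class (flip (cell R i) A))) (hX M_class) (ge0 _ (vertex_class _))
  (ge0 _ (vertex_class _)) (ge0 _ M_class) M_geom.
apply: le_trans; rewrite lee_fin.
have -> : (vertex (flip (cell R i) A) i - vertex A i) ^+ 2 = delta ^+ 2.
  by rewrite !ffunE eqxx; case: (A _) => /=; ring.
apply: ler_wpM2l; first exact: sqr_ge0.
under eq_bigr do rewrite M_gap.
rewrite -mulr_suml -natr_sum -big_mkcond/= sum1dep_card.
have := poisson_hellinger_le beta0 delta0; rewrite -/mid.
have := card_cell_fiber N (cell R i) RI.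
rewrite -(ler_nat K) !natrM natrX.
rewrite cardsE.
set n := #|_|; set H := (_ - _) => nR H_le.
have n_le : n%:R <= 2 * I%:R ^+ N.+1 / R.+1%:R :> K.
  by rewrite ler_pdivlMr ?ltr0n.
have nH_le : n%:R * H / 2 <= gap.
  apply: (@le_trans _ _
    (2 * I%:R ^+ N.+1 / R.+1%:R * (delta ^+ 2 / (4 * beta)) / 2)).
    rewrite ler_wpM2r// (le_trans (ler_wpM2l _ H_le))//.
    by rewrite ler_wpM2r// divr_ge0 ?sqr_ge0// mulr_ge0// ltW.
  suff -> : 2 * I%:R ^+ N.+1 / R.+1%:R * (delta ^+ 2 / (4 * beta)) / 2 = gap.
    by [].
  have R0 : R.+1%:R != 0 :> K by rewrite pnatr_eq0.
  rewrite /gap; move: (R.+1%:R) R0 => r r0.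
  by field; rewrite r0 gt_eqF.
have := expR_ge1Dx (- (n%:R * H) / 2).
lra.
Qed.

(** Assouad's bound: the supremum of the risk dominates its mean over the
    vertices, which splits into the mean errors at the single positions. *)
Lemma cp_class_sup_risk_ge (Mhat : tensor N.+2 I nat -> tensor N.+2 I K) B :
  (forall M, cp_class R.+1 beta alpha M -> (risk (P M) X Mhat M <= B)%E) ->
  ((I%:R ^+ N.+2 * (delta ^+ 2 * (1 / 2 - gap) / 2))%:E <= B)%E.
Proof.
move=> risk_le.
apply: (@le_of_le_sum K {ffun 'I_I * 'I_R.+1 -> bool}
  (fun A => risk (P (vertex A)) X Mhat (vertex A))) => [|A|].
- by apply/card_gt0P; exists [ffun=> true].
- exact: risk_le.
under eq_bigr do rewrite (risk_sum Mhat (hX (vertex_class _))).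
rewrite exchange_big/=.
set D := delta ^+ 2 * _; set n := #|_|.
have -> : ((n%:R * (I%:R ^+ N.+2 * (D / 2)))%:E =
    \sum_(i : multi_index N.+2 I) (n%:R * (D / 2))%:E)%E.
  rewrite sumEFin sumr_const card_ffun !card_ord.
  rewrite -(mulr_natl (n%:R * (D / 2))) natrX.
  by rewrite mulrCA.
by apply: lee_sum => i _; apply: sum_flip_ge => A; exact: vertex_pair_error.
Qed.

End Assouad.

(** * The minimax bound *)

Theorem theorem5 (K : realType) (N I R : nat) (beta alpha : K)
    (d : measure_display) (Omega : measurableType d)
    (P : tensor N I K -> probability Omega K)
    (X : Omega -> tensor N I nat)
    (hN : (2 <= N)%N) (hbeta : 0 < beta) (halpha : beta < alpha)
    (hRI : (R <= I)%N) (hIR : (16 < I * R)%N)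
    (hsize : ((I * R)%:R / 16 - 1) * (beta * ln 2 / (alpha - beta) ^+ 2)
             <= I%:R ^+ N)
    (hX : forall M : tensor N I K,
        cp_class R beta alpha M -> poisson_tensor (P M) X M) :
  ((beta * ln 2 / 128 * ((I * R)%:R / 16 - 1))%:E
    <= minimax_risk P X (cp_class R beta alpha))%E.
Proof.
case: N => [|[|n]] // in P X hN hsize hX *.
case: R => [|r] in hRI hIR hsize hX *; first by rewrite muln0 in hIR.
apply/ereal_infP => _ [Mhat Mhat_class <-].
pose Q := ((I * r.+1)%:R / 16 - 1) * (beta * ln 2).
have IR_gt : 16 < (I * r.+1)%:R :> K by rewrite ltr_nat.
have I0 : 0 < I%:R :> K.
  by rewrite ltr0n; case: I hIR {X P hRI hsize hX Mhat Mhat_class IR_gt Q}.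
have r0 : 0 < r.+1%:R :> K by rewrite ltr0n.
have ln2_gt0 : 0 < ln 2 :> K by rewrite ln_gt0// ltr1n.
have ln2_le1 : ln 2 <= 1 :> K.
  by have := @le_ln1Dx K 1; rewrite (_ : 1 + 1 = 2)//; apply; lra.
have Q0 : 0 <= Q.
  by rewrite mulr_ge0 ?mulr_ge0 ?(ltW hbeta) ?(ltW ln2_gt0)//; lra.
(* The side of the hypercube: [I^N delta^2 = Q], the largest value for which
   the size hypothesis guarantees [beta + delta <= alpha]. *)
pose delta := Num.sqrt (Q / I%:R ^+ n.+2).
have deltaE : delta ^+ 2 = Q / I%:R ^+ n.+2.
  by rewrite sqr_sqrtr// divr_ge0// exprn_ge0// ltW.
have In0 : 0 < I%:R ^+ n.+2 :> K by rewrite exprn_gt0.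
have ab0 : 0 < alpha - beta by rewrite subr_gt0.
have delta_le : beta + delta <= alpha.
  rewrite addrC -lerBrDr -(@ler_pXn2r _ 2)// ?nnegrE ?sqrtr_ge0 ?(ltW ab0)//.
  rewrite deltaE ler_pdivrMr// mulrC -ler_pdivrMr ?exprn_gt0//.
  by apply: le_trans hsize; rewrite /Q !mulrA.
have sup_ge M : cp_class r.+1 beta alpha M ->
    (risk (P M) X Mhat M <=
     ereal_sup [set risk (P M) X Mhat M | M in cp_class r.+1 beta alpha])%E.
  by move=> M_class; apply: ereal_sup_ubound; exists M.
have := cp_class_sup_risk_ge hbeta (sqrtr_ge0 _) delta_le hRI hX sup_ge.
apply: le_trans; rewrite lee_fin -/delta deltaE.
have -> : I%:R ^+ n.+2 * (Q / I%:R ^+ n.+2 *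
    (1 / 2 - Q / I%:R ^+ n.+2 * I%:R ^+ n.+1 / (4 * beta * r.+1%:R)) / 2) =
  Q * (1 / 2 - Q / (4 * beta * (I * r.+1)%:R)) / 2.
  rewrite [in RHS]natrM exprS; field.
  by rewrite !gt_eqF// exprn_gt0.
have gap_le : Q / (4 * beta * (I * r.+1)%:R) <= 1 / 64.
  rewrite ler_pdivrMr; last by rewrite !mulr_gt0//; lra.
  apply: (@le_trans _ _ ((I * r.+1)%:R / 16 * (beta * 1))); last by lra.
  have bl0 : 0 <= beta * ln 2 by rewrite mulr_ge0 ?(ltW hbeta) ?(ltW ln2_gt0).
  apply: ler_pM => //; [lra | lra | by rewrite ler_pM2l].
have -> : beta * ln 2 / 128 * ((I * r.+1)%:R / 16 - 1) = Q * (1 / 128).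
  by rewrite /Q; field.
move: (Q / _) gap_le => t t_le.
by rewrite -[leRHS]mulrA; apply: ler_wpM2l => //; lra.
Qed.
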